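(* Let $m\in\mathbb{N}$, $m\ge1$, let $A\subseteq\mathbb{N}^m$ be a finite non-empty complete set of multi-indices, for $i=1,\dots,m$ let $n_i=\max_{\alpha\in A}\alpha_i$ and let $p_{0,i},\dots,p_{n_i,i}$ be pairwise distinct real numbers. Let $Q(x)=\sum_{\alpha\in A}c_\alpha N_\alpha(x)$, $c_\alpha\in\mathbb{R}$, be a polynomial in Newton form, where $N_\alpha(x)=\prod_{i=1}^m\prod_{j=0}^{\alpha_i-1}(x_i-p_{j,i})$. Then it requires $\mathcal{O}(|A|)$ operations to evaluate $Q$ at any $x_0\in\mathbb{R}^m$.
   Context: $\mathbb{N}$ contains $0$ when used for multi-indices. $A$ is complete (downward closed) if $\alpha\in A$, $\beta\in\mathbb{N}^m$ and $\beta_i\le\alpha_i$ for all $i$ imply $\beta\in A$. Empty products are $1$. Operations are real arithmetic operations; the input consists of the coefficients $c_\alpha$, the numbers $p_{j,i}$ and the point $x_0$; the statement is an upper bound (there is an evaluation procedure using at most a constant times $|A|$ operations), with an absolute implied constant. *)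

(* Defs.v *)
From HB Require Import structures.
From mathcomp Require Import all_boot all_order all_algebra.
From mathcomp Require Import finmap mpoly reals.

Set Implicit Arguments.
Unset Strict Implicit.
Unset Printing Implicit Defensive.

Import GRing.Theory.
Local Open Scope ring_scope.

(* The cost model: straight-line programs over the four arithmetic           *)
(* operations. The operands of an operation are inputs or results of earlier *)
(* operations; reading an operand is free, each operation costs 1.           *)

Inductive arith_op := OpAdd | OpSub | OpMul | OpDiv.

Inductive operand (I : Type) :=
  | Input of I
  | Result of nat.  (* Result k: value of the k-th operation, from 0 *)

Record instruction (I : Type) := Instruction {
  instr_op : arith_op;
  instr_left : operand I;
  instr_right : operand I }.

Record slp (I : Type) := Slp {
  slp_code : seq (instruction I);
  slp_output : operand I }.

Definition slp_cost (I : Type) (P : slp I) : nat := size (slp_code P).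

Section Semantics.
Variables (F : fieldType) (I : Type) (env : I -> F).

(* Division by zero is an error, unlike MathComp's total x / 0 = 0. *)
Definition arith_eval (o : arith_op) (x y : F) : option F :=
  match o with
  | OpAdd => Some (x + y)
  | OpSub => Some (x - y)
  | OpMul => Some (x * y)
  | OpDiv => if y == 0 then None else Some (x / y)
  end.

(* mem lists the results of the operations executed so far, oldest first. *)
Definition operand_eval (mem : seq F) (a : operand I) : option F :=
  match a with
  | Input i => Some (env i)
  | Result k => onth mem k
  end.

Definition instr_eval (mem : seq F) (s : instruction I) : option F :=
  if operand_eval mem (instr_left s) is Some x then
    if operand_eval mem (instr_right s) is Some y then
      arith_eval (instr_op s) x y
    else None
  else None.

Fixpoint code_eval (mem : seq F) (code : seq (instruction I)) :
    option (seq F) :=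
  if code is s :: code' then
    if instr_eval mem s is Some z then code_eval (rcons mem z) code' else None
  else Some mem.

Definition slp_eval (P : slp I) : option F :=
  if code_eval [::] (slp_code P) is Some mem then
    operand_eval mem (slp_output P)
  else None.

End Semantics.

Section Newton.
Variables (m : nat).

Definition complete_set (A : {fset 'X_{1..m}}) : Prop :=
  forall a b : 'X_{1..m},
    a \in A -> (forall i : 'I_m, (b i <= a i)%N) -> b \in A.

Definition max_index (A : {fset 'X_{1..m}}) (i : 'I_m) : nat :=
  \max_(a <- A) a i.

(* p i j is the point p_{j,i}; values with j > n_i, like the coefficients    *)
(* c a with a outside A below, do not enter the Newton form. *)
Definition distinct_nodes (R : realType) (A : {fset 'X_{1..m}})
    (p : 'I_m -> nat -> R) : Prop :=
  forall (i : 'I_m) (j k : nat),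
    (j <= max_index A i)%N -> (k <= max_index A i)%N -> p i j = p i k -> j = k.

Definition newton_basis (R : realType) (p : 'I_m -> nat -> R)
    (a : 'X_{1..m}) : {mpoly R[m]} :=
  \prod_(i < m) \prod_(j < a i) ('X_i - (p i j)%:MP).

Definition newton_form (R : realType) (A : {fset 'X_{1..m}})
    (c : 'X_{1..m} -> R) (p : 'I_m -> nat -> R) : {mpoly R[m]} :=
  \sum_(a <- A) c a *: newton_basis p a.

Inductive newton_input :=
  | Coef of 'X_{1..m}
  | Node of 'I_m & nat
  | Point of 'I_m.

Definition newton_env (R : realType) (c : 'X_{1..m} -> R)
    (p : 'I_m -> nat -> R) (x : 'I_m -> R) (v : newton_input) : R :=
  match v with
  | Coef a => c a
  | Node i j => p i j
  | Point i => x i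
  end.

End Newton.

(* Main.v *)
Require Import Defs.
From HB Require Import structures.
From mathcomp Require Import all_boot all_order all_algebra.
From mathcomp Require Import finmap mpoly reals.

(* Generalized Horner scheme: for nonzero a in A pick i with a_i > 0 and put
   b = a - e_i, which lies in A by completeness. Then
   N_a(x) = N_b(x) (x_i - p_{i,a_i-1}), so for a of maximal degree the term
   c_a N_a(x) can be merged into the one of b by replacing c_b with
   c_b + c_a (x_i - p_{i,a_i-1}), at the cost of three operations. Deleting a
   leaves a complete set; at the end only the term c_0 N_0(x) = c_0 is left. *)

Set Implicit Arguments.
Unset Strict Implicit.
Unset Printing Implicit Defensive.

Import GRing.Theory.
Local Open Scope ring_scope.

Lemma onth_cat_Some (T : Type) (s t : seq T) (k : nat) (z : T) :
  onth s k = Some z -> onth (s ++ t) k = Some z.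
Proof.
elim: s k => [|y s IHs] [|k] //=; exact: IHs.
Qed.

Lemma onth_cat_size (T : Type) (s t : seq T) (k : nat) :
  onth (s ++ t) (size s + k) = onth t k.
Proof. by elim: s => [|y s IHs] //=; rewrite addSn. Qed.

(** Memory only grows at its end, so an operand that already has a value keeps it after further
    operations. *)
Lemma operand_eval_cat (F : fieldType) (I : Type) (env : I -> F)
    (mem mem' : seq F) (o : operand I) (z : F) :
  operand_eval env mem o = Some z -> operand_eval env (mem ++ mem') o = Some z.
Proof. by case: o => [i|k] //=; exact: onth_cat_Some. Qed.

Lemma operand_eval_result (F : fieldType) (I : Type) (env : I -> F)
    (mem mem' : seq F) (k : nat) :
  operand_eval env (mem ++ mem') (Result I (size mem + k)) = onth mem' k.
Proof. exact: onth_cat_size. Qed.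

Section Multiindices.
Variable m : nat.
Implicit Types (a b : 'X_{1..m}) (A : {fset 'X_{1..m}}).
Local Open Scope fset_scope.

(** Degrees add in [b = (b - a) + a], so [b - a] has degree 0 and vanishes. *)
Lemma lem_mdeg_eq a b :
  (forall i : 'I_m, (a i <= b i)%N) -> (mdeg b <= mdeg a)%N -> a = b.
Proof.
move=> /mnm_lepP le_ab; rewrite -{1}(submK le_ab) mdegD -{2}[mdeg a]add0n.
rewrite leq_add2r leqn0 mdeg_eq0 => /eqP E.
by rewrite -(submK le_ab) E add0m.
Qed.

Lemma exists_max_mdeg A : A != fset0 ->
  exists2 a, a \in A & forall b, b \in A -> (mdeg b <= mdeg a)%N.
Proof.
case/fset0Pn => a0 a0A.
have [a _ max_a] := @arg_maxnP A [` a0A] xpredT (fun b : A => mdeg (val b)) isT.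
exists (val a) => [|b bA]; first exact: valP.
exact: (max_a [` bA]).
Qed.

(** An element of [A] lying above [a] has degree at least that of [a], so by maximality it is [a]
    itself: no other element needs [a] below it. *)
Lemma complete_setD1 A a :
  complete_set A -> (forall b, b \in A -> (mdeg b <= mdeg a)%N) ->
  complete_set (A `\ a).
Proof.
move=> cA max_a b b'; rewrite !inE => /andP[neq_ba bA] le_b'b.
rewrite (cA _ _ bA le_b'b) andbT; apply: contraNneq neq_ba => Eb'.
by apply/eqP/esym; rewrite Eb' in le_b'b; apply: lem_mdeg_eq => //; apply: max_a.
Qed.

End Multiindices.

Section NewtonValue.
Variables (R : realType) (m : nat) (p : 'I_m -> nat -> R) (x : 'I_m -> R).

Definition newton_value (a : 'X_{1..m}) : R :=
  \prod_(i < m) \prod_(j < a i) (x i - p i j).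

Lemma meval_newton_form (A : {fset 'X_{1..m}}) (c : 'X_{1..m} -> R) :
  (newton_form A c p).@[x] = \sum_(a <- A) c a * newton_value a.
Proof.
rewrite /newton_form rmorph_sum; apply: eq_bigr => a _.
rewrite /= mevalZ /newton_basis rmorph_prod; congr (_ * _).
apply: eq_bigr => i _; rewrite rmorph_prod; apply: eq_bigr => j _.
by rewrite /= mevalB mevalXU mevalC.
Qed.

Lemma newton_value0 : newton_value 0%MM = 1.
Proof. by rewrite /newton_value big1 // => i _; rewrite mnm0E big_ord0. Qed.

(** Only the inner product at [i] changes: it loses its last factor. *)
Lemma newton_value_pred (a : 'X_{1..m}) (i : 'I_m) : (0 < a i)%N ->
  newton_value a = newton_value (a - U_(i))%MM * (x i - p i (a i).-1).
Proof.
move=> ai_gt0; rewrite /newton_value (bigD1 i) //= [in RHS](bigD1 i) //=.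
rewrite mnmBE mnm1E eqxx subn1.
have -> : \prod_(j < a i) (x i - p i j) =
          \prod_(j < (a i).-1) (x i - p i j) * (x i - p i (a i).-1).
  by case: (a i) ai_gt0 => // r _; rewrite big_ord_recr.
rewrite mulrAC; congr (_ * _ * _); apply: eq_bigr => j ne_ji.
by rewrite mnmBE mnm1E eq_sym (negPf ne_ji) subn0.
Qed.

End NewtonValue.

(* The coefficients are held in arbitrary operands w, with values v, and k
   results are already in memory: this makes the induction go through, since
   merging a term overwrites a coefficient by a computed value. *)
Lemma newton_code (R : realType) (m k : nat) (A : {fset 'X_{1..m}})
    (w : 'X_{1..m} -> operand (newton_input m)) :
  A != fset0 -> complete_set A ->
  exists (code : seq (instruction (newton_input m)))
         (out : operand (newton_input m)),
    (size code <= 3 * #|` A|)%N /\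
    forall (p : 'I_m -> nat -> R) (c : 'X_{1..m} -> R) (x : 'I_m -> R)
           (mem : seq R) (v : 'X_{1..m} -> R),
      size mem = k ->
      (forall a, a \in A ->
        operand_eval (newton_env c p x) mem (w a) = Some (v a)) ->
      exists2 mem', code_eval (newton_env c p x) mem code = Some mem' &
        operand_eval (newton_env c p x) mem' out =
          Some (\sum_(a <- A) v a * newton_value p x a).
Proof.
move: {2}#|` A| (erefl #|` A|) => n.
elim: n A k w => [|n IHn] A k w cardA A_neq0 cA.
  by rewrite -cardfs_gt0 cardA in A_neq0.
have [a aA max_a] := exists_max_mdeg A_neq0.
(* If the maximal degree is 0, then [A] is the singleton of 0, and the empty program that outputs
   [w 0] suffices. *)
have [a0|a_neq0] := eqVneq a 0%MM.
  have -> : A = [fset 0%MM]%fset.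
    apply/fsetP => b; rewrite inE; apply/idP/eqP => [bA|->]; last by rewrite -a0.
    by apply/eqP; rewrite -mdeg_eq0 -leqn0 -[0%N](@mdeg0 m) -a0 max_a.
  exists [::], (w 0%MM); split=> // p c x mem v _ vP; exists mem => //.
  by rewrite big_seq_fset1 newton_value0 mulr1 vP // inE.
have /existsP[i ai_neq0] : [exists i, a i != 0%N].
  apply: contraNT a_neq0; rewrite negb_exists => /forallP ai0.
  by apply/eqP/mnmP => i; rewrite mnm0E; apply/eqP; rewrite -[_ == _]negbK ai0.
have ai_gt0 : (0 < a i)%N by rewrite lt0n.
pose b := (a - U_(i))%MM.
have neq_ba : b != a.
  (* Subtraction is truncated: [b = a] would mean [(a i).-1 = a i], which holds only for
     [a i = 0]. *)
  apply: contraTneq ai_gt0 => /mnmP/(_ i); rewrite mnmBE mnm1E eqxx subn1.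
  by case: (a i) => // r /n_Sn.
have bA' : b \in (A `\ a)%fset.
  by rewrite !inE neq_ba; apply: (cA a) => // j; rewrite mnmBE leq_subr.
have bA : b \in A by move: bA'; rewrite inE => /andP[].
(* These write [t], [v a * t] and [v b + v a * t] to positions [k], [k + 1] and [k + 2]; from then
   on [w'] reads the coefficient of [b] at [k + 2]. *)
pose merge := [:: Instruction OpSub (Input (Point i)) (Input (Node i (a i).-1));
                  Instruction OpMul (w a) (Result _ k);
                  Instruction OpAdd (w b) (Result _ (k + 1))].
pose w' d := if d == b then Result _ k.+2 else w d.
have cardA' : #|` (A `\ a)%fset| = n.
  by apply/eq_add_S; rewrite -cardA (cardfsD1 a A) aA.
have A'_neq0 : (A `\ a)%fset != fset0 by apply/fset0Pn; exists b.
have [code [out [le_code codeP]]] :=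
  IHn _ (k + 3)%N w' cardA' A'_neq0 (complete_setD1 cA max_a).
exists (merge ++ code), out; split.
  by rewrite size_cat cardA mulnS leq_add2l -cardA'.
move=> p c x mem v mem_k vP; pose t := x i - p i (a i).-1.
pose v' d := if d == b then v b + v a * t else v d.
pose mem3 := mem ++ [:: t; v a * t; v b + v a * t].
have mem_at0 z : onth (mem ++ [:: z]) k = Some z.
  by rewrite -mem_k -[size mem]addn0 onth_cat_size.
have mem_at1 y z : onth (mem ++ [:: y; z]) (k + 1) = Some z.
  by rewrite -mem_k onth_cat_size.
have eval_merge : code_eval (newton_env c p x) mem (merge ++ code) =
                  code_eval (newton_env c p x) mem3 code.
  rewrite /= /instr_eval /= -!cats1 (operand_eval_cat _ (vP a aA)) mem_at0 /=.
  by rewrite -!cats1 -catA /= (operand_eval_cat _ (vP b bA)) mem_at1 /= -cats1 -catA.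
have vP' d : d \in (A `\ a)%fset ->
    operand_eval (newton_env c p x) mem3 (w' d) = Some (v' d).
  rewrite inE /w' /v' => /andP[_ dA]; case: eqP => _.
    by rewrite -mem_k -addn2 operand_eval_result.
  exact/operand_eval_cat/vP.
have [|mem' codeE outE] := codeP p c x mem3 v' _ vP'.
  by rewrite size_cat mem_k.
exists mem'; first by rewrite eval_merge.
(* Split [a] off the sum over [A], then [b] off both sums. The remaining terms agree since [v']
   differs from [v] only at [b]; the rest is the recurrence for [newton_value] at [a]. *)
rewrite outE; congr Some; rewrite (big_fsetD1 a aA) /=.
rewrite (big_fsetD1 b bA') /= [in RHS](big_fsetD1 b bA') /= addrA.
congr (_ + _); last first.
  by apply: eq_fbigr => d; rewrite !inE /v' => /andP[/negPf-> _].
rewrite /v' eqxx (newton_value_pred p x ai_gt0) mulrDl addrC.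
by congr (_ + _); rewrite -mulrA [t * _]mulrC.
Qed.

Theorem corollary3p5 (R : realType) :
  exists C : nat,
  forall (m : nat) (A : {fset 'X_{1..m}}),
    (1 <= m)%N -> A != fset0 -> complete_set A ->
    exists P : slp (newton_input m),
      (slp_cost P <= C * #|` A|)%N /\
      forall (p : 'I_m -> nat -> R) (c : 'X_{1..m} -> R) (x0 : 'I_m -> R),
        distinct_nodes A p ->
        slp_eval (newton_env c p x0) P = Some (newton_form A c p).@[x0].
Proof.
(* Three operations per merge. The program starts with empty memory and every coefficient read
   directly from the input. *)
exists 3%N => m A _ A_neq0 cA.
have [code [out [le_code codeP]]] :=
  newton_code R 0 (fun a => Input (Coef a)) A_neq0 cA.
exists (Slp code out); split=> // p c x0 _.
have [//|//|mem codeE outE] := codeP p c x0 [::] c.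
by rewrite /slp_eval /= codeE outE meval_newton_form.
Qed.
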